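(* Let $\mathcal{H},\mathcal{K}$ be Hilbert spaces, and let $S$ and $T$ be linear operators acting between $\mathcal{H}$ and $\mathcal{K}$, respectively between $\mathcal{K}$ and $\mathcal{H}$. The following statements are equivalent: (i) (a) $S$ is closable; (b) $T$ is densely defined; (c) $\bar S=T^*$; (ii) (a) $S\wedge T$; (b) $\{\operatorname{ran}T\}^\perp=N_S$; (c) $Q_S=R_T$.
   Context: Hilbert spaces are over the same scalar field, $\mathbb{R}$ or $\mathbb{C}$. A linear operator $S$ acting between $\mathcal{H}$ and $\mathcal{K}$ is a linear map $S:\operatorname{dom}S\to\mathcal{K}$ defined on a linear subspace $\operatorname{dom}S\subseteq\mathcal{H}$; it is not assumed bounded, closed or densely defined unless stated. $S$ is closable if the closure of its graph is the graph of an operator, denoted $\bar S$. Equality of operators includes equality of domains. The adjoint $T^*$ of a densely defined $T$ has domain $\{h\in\mathcal{H}:\exists k'\in\mathcal{K}\ \forall k\in\operatorname{dom}T,\ \langle Tk,h\rangle=\langle k,k'\rangle\}$ and $T^*h:=k'$. $S\wedge T$ means $\langle Sh,k\rangle=\langle h,Tk\rangle$ for all $h\in\operatorname{dom}S$, $k\in\operatorname{dom}T$. For an operator $S$ between $\mathcal{H}$ and $\mathcal{K}$: $N_S:=\{h\in\mathcal{H}:$ there exists a sequence $\{h_n\}_n\subseteq\operatorname{dom}S$ converging to $h$ such that $\{Sh_n\}_n$ converges and, for any such $\{h_n\}_n$, $\lim_{n\to\infty}Sh_n=0\}$; $Q_S:=\{k\in\mathcal{K}:$ there exists a convergent sequence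 $\{h_n\}_n\subseteq\operatorname{dom}S$ such that $\lim_{n\to\infty}Sh_n=k\}$ (convergent in $\mathcal{H}$; the limit need not lie in $\operatorname{dom}S$); $R_S:=\{h\in\mathcal{H}:\sup\{|\langle h,h'\rangle|:h'\in\operatorname{dom}S,\ \|Sh'\|\le1\}<\infty\}$. Accordingly, $R_T=\{k\in\mathcal{K}:\sup\{|\langle k,k'\rangle|:k'\in\operatorname{dom}T,\ \|Tk'\|\le1\}<\infty\}$. *)

(* Defs.v *)
From HB Require Import structures.
From mathcomp Require Import all_boot all_order all_algebra.
From mathcomp Require Import all_classical all_reals all_analysis.
From mathcomp Require Import complex.

Set Implicit Arguments.
Unset Strict Implicit.
Unset Printing Implicit Defensive.

Import Order.TTheory GRing.Theory Num.Theory.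
Import numFieldNormedType.Exports.

Local Open Scope classical_set_scope.
Local Open Scope ring_scope.

(* The scalar field F with its conjugation is the field of real numbers, or the
   field of complex numbers over it. *)
Inductive real_or_complex (R : realType) :
    forall F : numFieldType, (F -> F) -> Prop :=
| RealScalars : @real_or_complex R R idfun
| ComplexScalars : @real_or_complex R R[i] (@conjc R).

(* Following the library, the inner product is linear in its first argument,
   and norms take their values in F (in its nonnegative, hence real, part). *)
Record hilbert (F : numFieldType) (conj : F -> F) := Hilbert {
  hilbert_space :> completeNormedModType F ;
  inner : {dot hilbert_space for conj} ;
  inner_norm : forall x : hilbert_space, inner x x = `|x| ^+ 2
}.

Notation "''<' x , y '>'" := (@inner _ _ _ x y)
  (at level 2, x at level 69, y at level 69, format "''<' x ,  y '>'") :
  ring_scope.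

(* The function underlying a linear operator is total; its values outside the
   domain are irrelevant, so that operators are compared with [op_eq]. *)
Record linop (F : numFieldType) (conj : F -> F) (H K : hilbert conj) := Linop {
  dom : set H ;
  op_fun :> H -> K ;
  dom0 : dom 0 ;
  dom_linear : forall (a : F) (x y : H), dom x -> dom y -> dom (a *: x + y) ;
  op_linear : forall (a : F) (x y : H), dom x -> dom y ->
    op_fun (a *: x + y) = a *: op_fun x + op_fun y
}.

Section Operators.
Variables (F : numFieldType) (conj : F -> F).
Implicit Types H K : hilbert conj.

Definition op_eq H K (S T : linop H K) : Prop :=
  dom S = dom T /\ forall h, dom S h -> S h = T h.

Definition graph H K (S : linop H K) : set (H * K) :=
  [set p | dom S p.1 /\ p.2 = S p.1].

Definition ran H K (S : linop H K) : set K := S @` dom S.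

Definition closable H K (S : linop H K) : Prop :=
  exists S' : linop H K, graph S' = closure (graph S).

(* The operator is determined up to [op_eq] by its graph, so the choice made by
   [cid] is immaterial. *)
Definition op_closure H K (S : linop H K) (cS : closable S) : linop H K :=
  projT1 (cid cS).

Definition densely_defined H K (S : linop H K) : Prop := dense (dom S).

Definition orthogonal_complement H (A : set H) : set H :=
  [set h | forall a, A a -> '<h, a> = 0].

Lemma innerC H (x y : H) : '<x, y> = conj '<y, x>.
Proof.
by have /= := @hermitian_subproof _ _ _ _ (inner H) x y; rewrite expr0 mul1r.
Qed.

Lemma innerBl H (x y z : H) : '<x - y, z> = '<x, z> - '<y, z>.
Proof. exact: linearBl. Qed.

Lemma inner_linear H (x : H) (a : F) (y z : H) :
  '<x, a *: y + z> = conj a * '<x, y> + '<x, z>.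
Proof. by rewrite linearDr linearZr_LR. Qed.

Lemma innerBr H (x y z : H) : '<x, y - z> = '<x, y> - '<x, z>.
Proof. exact: linearBr. Qed.

Lemma dense_inner_inj H (D : set H) (y z : H) :
  dense D -> (forall x, D x -> '<x, y> = '<x, z>) -> y = z.
Proof.
move=> dD yz; apply/eqP; rewrite -subr_eq0; apply/negPn/negP => w0.
have Dw x : D x -> '<x, y - z> = 0 by move=> Dx; rewrite innerBr yz ?subrr.
move: (y - z) w0 Dw => w w0 Dw.
have nw : 0 < `|w| by rewrite normr_gt0.
have [|x [wx Dx]] := dD (ball w `|w|) _ (ball_open w `|w|).
  by exists w; exact: ballxx.
have wx0 : '<w, x> = 0.
  by rewrite innerC Dw // -(linear0r (inner H) x) -innerC linear0l linear0r.
move: wx; rewrite -ball_normE /= => wx.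
have : `|w - x| ^+ 2 < `|w| ^+ 2 by rewrite ltr_pXn2r // nnegrE.
rewrite -!inner_norm innerBl !innerBr wx0 (Dw x Dx) subr0 sub0r opprK.
by rewrite gtrDl inner_norm le_gtF ?exprn_ge0.
Qed.

Definition adjoint_rel H K (T : linop H K) (h : K) (k' : H) : Prop :=
  forall k, dom T k -> '<T k, h> = '<k, k'>.

Definition adjoint_dom H K (T : linop H K) : set K :=
  [set h | exists k', adjoint_rel T h k'].

Definition adjoint_fun H K (T : linop H K) (h : K) : H :=
  xget 0 [set k' | adjoint_rel T h k'].

Lemma adjoint_funP H K (T : linop H K) (h : K) :
  adjoint_dom T h -> adjoint_rel T h (adjoint_fun T h).
Proof. by move=> Th; exact: (xgetPex 0 Th). Qed.

Lemma adjoint_rel_linear H K (T : linop H K) (a : F) (x y : K) (x' y' : H) :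
  adjoint_rel T x x' -> adjoint_rel T y y' ->
  adjoint_rel T (a *: x + y) (a *: x' + y').
Proof. by move=> xx' yy' k Tk; rewrite !inner_linear xx' // yy'. Qed.

Lemma adjoint_rel_inj H K (T : linop H K) (h : K) (x y : H) :
  densely_defined T -> adjoint_rel T h x -> adjoint_rel T h y -> x = y.
Proof.
by move=> dT hx hy; apply: (dense_inner_inj dT) => k Tk; rewrite -hx ?hy.
Qed.

Lemma adjoint_dom0 H K (T : linop H K) : adjoint_dom T 0.
Proof.
by exists 0 => k _; rewrite !linear0r.
Qed.

Lemma adjoint_dom_linear H K (T : linop H K) (a : F) (x y : K) :
  adjoint_dom T x -> adjoint_dom T y -> adjoint_dom T (a *: x + y).
Proof.
by move=> [x' xx'] [y' yy']; exists (a *: x' + y'); exact: adjoint_rel_linear.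
Qed.

Lemma adjoint_fun_linear H K (T : linop H K) (dT : densely_defined T)
    (a : F) (x y : K) : adjoint_dom T x -> adjoint_dom T y ->
  adjoint_fun T (a *: x + y) = a *: adjoint_fun T x + adjoint_fun T y.
Proof.
move=> Tx Ty; apply: (adjoint_rel_inj dT).
  by apply: adjoint_funP; exact: adjoint_dom_linear.
by apply: adjoint_rel_linear; exact: adjoint_funP.
Qed.

Definition adjoint H K (T : linop H K) (dT : densely_defined T) : linop K H :=
  @Linop F conj K H (adjoint_dom T) (adjoint_fun T) (adjoint_dom0 T)
    (@adjoint_dom_linear H K T) (@adjoint_fun_linear H K T dT).

(* The relation written S /\ T in the literature on adjoint pairs. *)
Definition wedge H K (S : linop H K) (T : linop K H) : Prop :=
  forall h k, dom S h -> dom T k -> '<S h, k> = '<h, T k>.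

Definition N_set H K (S : linop H K) : set H :=
  [set h |
    (exists u : nat -> H, [/\ forall n, dom S (u n),
       u n @[n --> \oo] --> h & cvg (S (u n) @[n --> \oo])]) /\
    (forall u : nat -> H, (forall n, dom S (u n)) ->
       u n @[n --> \oo] --> h -> cvg (S (u n) @[n --> \oo]) ->
       S (u n) @[n --> \oo] --> (0 : K))].

(* The limit of u need not belong to [dom S]. *)
Definition Q_set H K (S : linop H K) : set K :=
  [set k | exists u : nat -> H, [/\ forall n, dom S (u n),
     cvg (u n @[n --> \oo]) & S (u n) @[n --> \oo] --> k]].

(* The supremum of a set of norms is finite iff the set is bounded above. *)
Definition R_set H K (S : linop H K) : set H :=
  [set h | has_ubound
    ([set `|'<h, h'> : F| | h' in [set h' | dom S h' /\ `|S h'| <= 1]] : set F)].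

End Operators.

(* Main.v *)
Require Import Defs.
From mathcomp Require Import all_boot all_order all_algebra.
From mathcomp Require Import all_classical all_reals all_analysis.
From mathcomp Require Import complex ring.

(** Both sides of the equivalence compare two relations between vectors h of H
    and k of K: the closure of the graph of S, which consists of the limits of
    pairs (u n, S (u n)) ([closure_graphP]), and [adjoint_rel T], which says
    that <T t, h> = <t, k> for all t in dom T.  If T is densely defined, the
    second one is the graph of the adjoint of T, so that the left-hand
    side holds iff T is densely defined and the two relations coincide
    ([closure_eq_adjointP]).

    In these terms Q_S is the range of the closed graph, and N_S its kernel as
    soon as the closed graph is single-valued, while the orthogonal complement
    of ran T is the kernel of [adjoint_rel T].  The set R_T is the range of
    [adjoint_rel T] ([R_setP]): a bound for |<k, t>| by a multiple of |T t|
    makes T t |-> <t, k> a bounded functional on ran T, and the Riesz theorem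
    represents it by a vector h.  Hence the left-hand side gives the
    right-hand side by comparing kernels and ranges.

    Conversely, by continuity of the inner product, the condition [wedge S T]
    puts the closed graph inside [adjoint_rel T].  A vector k
    orthogonal to dom T satisfies [adjoint_rel T 0 k], so lies in
    R_T = Q_S and is the limit of some S (u n) with u n --> h; as
    [adjoint_rel T h k] gives h orthogonal to ran T, h is in N_S, which forces
    k = 0.  Hence dom T is dense.  Finally, if [adjoint_rel T h k], then k is
    in R_T = Q_S, so some (g, k) is in the closed graph; h - g is orthogonal to
    ran T, hence in N_S, and (h, k) = (g, k) + (h - g, 0) is in the closed
    graph.

    The two facts about completeness that this uses, the Riesz theorem and the
    density of a subspace with zero orthogonal complement, both follow from
    [weak_riesz], which is proved by minimising a quadratic functional. *)

Set Implicit Arguments.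
Unset Strict Implicit.
Unset Printing Implicit Defensive.

Import Order.TTheory GRing.Theory Num.Theory.
Import numFieldNormedType.Exports.

Local Open Scope classical_set_scope.
Local Open Scope ring_scope.

(** * Real and complex scalars *)

Lemma mul_conj (R : realType) (F : numFieldType) (conj : F -> F)
  (F_RC : real_or_complex R conj) (z : F) : z * conj z = `|z| ^+ 2.
Proof.
case: F conj / F_RC z => z /=; last by rewrite sqr_normc.
by rewrite -normrX ger0_norm ?sqr_ge0 ?expr2.
Qed.

Lemma conj_norm (R : realType) (F : numFieldType) (conj : F -> F)
  (F_RC : real_or_complex R conj) (z : F) : `|conj z| = `|z|.
Proof. by case: F conj / F_RC z => z //=; rewrite normcJ. Qed.

Lemma conjB (R : realType) (F : numFieldType) (conj : F -> F)
  (F_RC : real_or_complex R conj) (y z : F) : conj (y - z) = conj y - conj z.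
Proof. by case: F conj / F_RC y z => y z //=; rewrite rmorphB. Qed.

Lemma conj_real_mul (R : realType) (F : numFieldType) (conj : F -> F)
  (F_RC : real_or_complex R conj) (t z : F) :
  t \is Num.real -> conj (t * z) = t * conj z.
Proof.
case: F conj / F_RC t z => t z tr //=; rewrite rmorphM /=; congr (_ * _).
by case/complex_realP: tr => k ->; rewrite conjc_real.
Qed.

Lemma conjK (R : realType) (F : numFieldType) (conj : F -> F)
  (F_RC : real_or_complex R conj) (z : F) : conj (conj z) = z.
Proof. by case: F conj / F_RC z => z //=; rewrite conjcK. Qed.

(** The order of the complex numbers is partial, but e > 0 makes e real, and
    the field of real numbers is archimedean. *)
Lemma near_harmonic_lt (R : realType) (F : numFieldType) (conj : F -> F)
    (F_RC : real_or_complex R conj) (e : F) : 0 < e ->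
  \forall n \near \oo, n.+1%:R^-1 < e.
Proof.
case: F conj / F_RC e => e e0; first exact: (near_infty_natSinv_lt (PosNum e0)).
have /complex_realP[r er] : e \is Num.real by exact: gtr0_real.
have r0 : 0 < r by move: e0; rewrite er -(ltcR 0).
near=> n; rewrite er.
have -> : n.+1%:R^-1 = (n.+1%:R^-1)%:C%C :> R[i].
  by rewrite fmorphV rmorph_nat.
rewrite ltcR; near: n; exact: (near_infty_natSinv_lt (PosNum r0)).
Unshelve. all: by end_near. Qed.

(** The completeness of the real line, stated inside the scalar field: norms
    take their values there, even when the scalars are complex. *)
Lemma real_inf_exists (R : realType) (F : numFieldType) (conj : F -> F)
    (F_RC : real_or_complex R conj) (A : set F) (b : F) :
  A !=set0 -> (forall x, A x -> b <= x) -> (forall x, A x -> x \is Num.real) ->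
  exists m, (forall x, A x -> m <= x) /\
    (forall e, 0 < e -> exists2 x, A x & x < m + e).
Proof.
case: F conj / F_RC A b => A b [x0 Ax0] Ab Ar.
  have hA : has_inf A by split; [exists x0|exists b].
  exists (inf A); split.
    by move=> x Ax; apply: ge_inf => //; exact: hA.2.
  by move=> e e0; have [x Ax xe] := inf_adherent e0 hA; exists x.
pose B := [set r : R | A r%:C%C].
have hB : has_inf B.
  split.
    by case/complex_realP: (Ar _ Ax0) => r er; exists r; rewrite /B /= -er.
  exists (complex.Re b) => r /Ab; rewrite lecE => /andP[_] //=.
exists (inf B)%:C%C; split.
  move=> x Ax; have /complex_realP[r xr] := Ar _ Ax.
  rewrite xr lecR; apply: ge_inf; first exact: hB.2.
  by rewrite /B /= -xr.
move=> e e0; have /complex_realP[r er] : e \is Num.real by exact: gtr0_real.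
have r0 : 0 < r by move: e0; rewrite er -(ltcR 0).
have [x Bx xe] := inf_adherent r0 hB; exists x%:C%C => //.
by rewrite er -rmorphD ltcR.
Qed.

Section HilbertSpace.
Variables (R : realType) (F : numFieldType) (conj : F -> F).
Hypothesis F_RC : real_or_complex R conj.
Implicit Types H K : hilbert conj.

(** * Inner products *)

Lemma innerDl H (x y z : H) : '<x + y, z> = '<x, z> + '<y, z>.
Proof. exact: linearDl. Qed.

Lemma innerZl H a (x y : H) : '<a *: x, y> = a * '<x, y>.
Proof. exact: linearZl_LR. Qed.

Lemma innerZr H a (x y : H) : '<x, a *: y> = conj a * '<x, y>.
Proof. by rewrite linearZr_LR. Qed.

Lemma innerDr H (x y z : H) : '<x, y + z> = '<x, y> + '<x, z>.
Proof. by rewrite linearDr. Qed.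

Lemma inner_norm_sym H (x y : H) : `|'<x, y>| = `|'<y, x>|.
Proof. by rewrite innerC (conj_norm F_RC). Qed.

Lemma innerZr_real H t (x y : H) : t \is Num.real -> '<x, t *: y> = t * '<x, y>.
Proof. by move=> tr; rewrite innerC innerZl (conj_real_mul F_RC) -?innerC. Qed.

Lemma inner0_sym H (x y : H) : '<x, y> = 0 -> '<y, x> = 0.
Proof.
by move=> xy; apply/eqP; rewrite -normr_eq0 inner_norm_sym xy normr0.
Qed.

Lemma normr_sqrD H (x y : H) :
  `|x + y| ^+ 2 = `|x| ^+ 2 + ('<x, y> + '<y, x>) + `|y| ^+ 2.
Proof. by rewrite -!inner_norm !(innerDl, innerDr); ring. Qed.

Lemma inner_symm_real H (x y : H) : '<x, y> + '<y, x> \is Num.real.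
Proof.
have -> : '<x, y> + '<y, x> = `|x + y| ^+ 2 - `|x| ^+ 2 - `|y| ^+ 2.
  by rewrite normr_sqrD; ring.
by rewrite !rpredB ?rpredX ?normr_real.
Qed.

(** For z = <x, y> the term linear in t is - 2 t |z| ^ 2, whence the
    Cauchy-Schwarz inequality; in [energy_step], z is instead half the
    gradient of the energy, paired with the direction. *)
Lemma perturb_sqr H (x y : H) (z t : F) : t \is Num.real ->
  `|(- t * conj z) *: x + y| ^+ 2 =
  t ^+ 2 * `|z| ^+ 2 * `|x| ^+ 2 - t * (conj z * '<x, y> + z * '<y, x>)
  + `|y| ^+ 2.
Proof.
move=> tr; rewrite normr_sqrD normrZ innerZl innerZr.
rewrite (conj_real_mul F_RC) ?rpredN // (conjK F_RC).
rewrite exprMn normrM normrN (conj_norm F_RC) exprMn.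
by rewrite real_normK //; ring.
Qed.

Lemma cauchy_schwarz H (x y : H) : `|'<x, y>| <= `|x| * `|y|.
Proof.
have [->|x0] := eqVneq x 0; first by rewrite linear0l !normr0 mul0r.
have nx : 0 < `|x| by rewrite normr_gt0.
(* The value of t that minimises the right-hand side of [perturb_sqr]. *)
have tr : `|x| ^- 2 \is Num.real by rewrite rpredV rpredX ?normr_real.
have := perturb_sqr x y '<x, y> tr.
rewrite (innerC y x) (mulrC (conj _)) (mul_conj F_RC).
set w := `|_ + y|; have : 0 <= w ^+ 2 by rewrite exprn_ge0 ?normr_ge0.
move=> /[swap] ->.
have -> : `|x| ^- 2 ^+ 2 * `|'<x, y>| ^+ 2 * `|x| ^+ 2
  - `|x| ^- 2 * (`|'<x, y>| ^+ 2 + `|'<x, y>| ^+ 2) + `|y| ^+ 2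
  = (`|x| ^+ 2 * `|y| ^+ 2 - `|'<x, y>| ^+ 2) / `|x| ^+ 2.
  by field; rewrite lt0r_neq0.
rewrite pmulr_lge0 ?invr_gt0 ?exprn_gt0 // subr_ge0 -exprMn.
by rewrite ler_pXn2r // nnegrE ?mulr_ge0 ?normr_ge0.
Qed.

Lemma cvg_inner H (u : nat -> H) (x y : H) :
  u n @[n --> \oo] --> x -> ('<u n, y> : F^o) @[n --> \oo] --> ('<x, y> : F^o).
Proof.
move=> ux; apply/cvgrPdist_lt => e e0.
have y1 : 0 < `|y| + 1 by rewrite ltr_wpDl.
move/cvgrPdist_lt: ux => /(_ _ (divr_gt0 e0 y1)); apply: filterS => n.
rewrite -innerBl ltr_pdivlMr // => une.
apply: le_lt_trans (cauchy_schwarz _ _) (le_lt_trans _ une).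
by rewrite ler_wpM2l // lerDl.
Qed.

Lemma cvg_inner_eq H K (u : nat -> H) (v : nat -> K) x y (x' : H) (y' : K) :
  u n @[n --> \oo] --> x -> v n @[n --> \oo] --> y ->
  (forall n, '<u n, x'> = '<v n, y'>) -> '<x, x'> = '<y, y'>.
Proof.
move=> /(@cvg_inner _ _ _ x') ux /(@cvg_inner _ _ _ y') vy uv.
apply: (cvg_unique (@norm_hausdorff F F^o) ux).
by rewrite (_ : (fun n => '<u n, x'>) = (fun n => '<v n, y'>)) //; apply/funext.
Qed.

(** * Limits along the graph of an operator *)

Lemma linopZ H K (S : linop H K) a x :
  dom S x -> dom S (a *: x) /\ S (a *: x) = a *: S x.
Proof.
have S0 : S 0 = 0.
  have := op_linear (-1) (dom0 S) (dom0 S).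
  by rewrite scaler0 addr0 scaleN1r addNr.
move=> Dx; rewrite -[a *: x]addr0; split; first exact: dom_linear Dx (dom0 S).
by rewrite op_linear ?S0 ?addr0 //; exact: dom0.
Qed.

Lemma linopD H K (S : linop H K) x y :
  dom S x -> dom S y -> dom S (x + y) /\ S (x + y) = S x + S y.
Proof.
move=> Dx Dy; rewrite -[x]scale1r; split; first exact: dom_linear.
by rewrite op_linear // !scale1r.
Qed.

Definition graph_limit H K (S : linop H K) (h : H) (k : K) : Prop :=
  exists u : nat -> H, [/\ forall n, dom S (u n),
    u n @[n --> \oo] --> h & S (u n) @[n --> \oo] --> k].

(** Sequences suffice because the balls of radius 1 / (n + 1) are a basis of
    neighbourhoods, the scalar field being archimedean. *)
Lemma closure_graphP H K (S : linop H K) h k :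
  closure (graph S) (h, k) <-> graph_limit S h k.
Proof.
split=> [cl|[u [Du uh uk]] B Bhk]; last first.
  have /filter_ex[n Bn] : \forall n \near \oo, B (u n, S (u n)).
    exact: (cvg_pair uh uk).
  by exists (u n, S (u n)); split; first by split; [exact: Du|].
have app (n : nat) : exists v, [/\ dom S v, `|h - v| < n.+1%:R^-1 &
    `|k - S v| < n.+1%:R^-1].
  have n0 : 0 < n.+1%:R^-1 :> F by rewrite invr_gt0.
  have [|[v w] [[/= Dv ->]]] := cl (ball (h, k) n.+1%:R^-1).
    exact: nbhsx_ballx.
  by rewrite /ball /= /prod_ball /= -!ball_normE => -[]; exists v.
have [u uP] := choice app.
exists u; split; first by move=> n; have [] := uP n.
  apply/cvgrPdist_lt => e /(near_harmonic_lt F_RC); apply: filterS => n.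
  by have [_ + _] := uP n; exact: lt_trans.
apply/cvgrPdist_lt => e /(near_harmonic_lt F_RC); apply: filterS => n.
by have [_ _ +] := uP n; exact: lt_trans.
Qed.

Lemma graph_limitD H K (S : linop H K) x y x' y' :
  graph_limit S x x' -> graph_limit S y y' -> graph_limit S (x + y) (x' + y').
Proof.
move=> [u [Du ux ux']] [v [Dv vy vy']]; exists (fun n => u n + v n); split.
- by move=> n; have [] := linopD (Du n) (Dv n).
- exact: cvgD.
- rewrite (_ : (fun n => S (u n + v n)) = (fun n => S (u n) + S (v n))).
    exact: cvgD.
  by apply/funext => n; have [] := linopD (Du n) (Dv n).
Qed.

Lemma graph_limit_adjoint H K (S : linop H K) (T : linop K H) h k :
  wedge S T -> graph_limit S h k -> adjoint_rel T h k.
Proof.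
move=> ST [u [Du uh Suk]] t Tt; rewrite innerC [RHS]innerC; congr (conj _).
by apply: (cvg_inner_eq uh Suk) => n; rewrite ST.
Qed.

(** * The Riesz theorem for the range of an operator *)

(** This is |T v| ^ 2 - 2 Re <v, k>, a convex function of v whose derivative in
    the direction w is 2 Re (<T w, T v> - <w, k>): it is minimal at v exactly
    when T v represents the functional T w |-> <w, k> on ran T. *)
Definition energy H K (T : linop K H) (k v : K) : F :=
  `|T v| ^+ 2 - ('<v, k> + '<k, v>).

Lemma energy_real H K (T : linop K H) k v : energy T k v \is Num.real.
Proof. by rewrite rpredB ?inner_symm_real // rpredX ?normr_real. Qed.

Lemma energy_ge H K (T : linop K H) k C v : 0 <= C ->
  `|'<v, k>| <= C * `|T v| -> - C ^+ 2 <= energy T k v.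
Proof.
move=> C0 TC; rewrite -subr_ge0.
have pr : '<v, k> + '<k, v> <= C * `|T v| + C * `|T v|.
  apply: le_trans (real_ler_norm (inner_symm_real _ _)) _.
  apply: le_trans (ler_normD _ _) _.
  by rewrite lerD // inner_norm_sym.
have -> : energy T k v - - C ^+ 2 =
    (C * `|T v| + C * `|T v| - ('<v, k> + '<k, v>)) + (`|T v| - C) ^+ 2.
  by rewrite /energy; ring.
rewrite addr_ge0 ?subr_ge0 // real_exprn_even_ge0 //.
by rewrite rpredB ?normr_real ?ger0_real.
Qed.

Lemma energy_step H K (T : linop K H) k v w t (z := '<T w, T v> - '<w, k>) :
  dom T v -> dom T w -> t \is Num.real ->
  energy T k ((- t * conj z) *: w + v) =
  energy T k v - t * `|z| ^+ 2 * (2 - t * `|T w| ^+ 2).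
Proof.
move=> Dv Dw tr.
have Tvw : '<T v, T w> = conj z + '<k, w>.
  by rewrite (conjB F_RC) -!innerC; ring.
rewrite /energy op_linear // (perturb_sqr _ _ _ tr) innerDl innerDr.
rewrite innerZl innerZr (conj_real_mul F_RC) ?rpredN // (conjK F_RC) Tvw.
have -> : '<T w, T v> = z + '<w, k> by rewrite /z; ring.
by rewrite -(mul_conj F_RC z); ring.
Qed.

(** The parallelogram identity for T v and T w; the linear part of the energy
    is the same at the midpoint and on average. *)
Lemma energy_midpoint H K (T : linop K H) k v w : dom T v -> dom T w ->
  exists2 x, dom T x & energy T k x =
    (energy T k v + energy T k w) / 2 - `|T v - T w| ^+ 2 / 4.
Proof.
move=> Dv Dw; have hr : 2^-1 \is @Num.real F by rewrite rpredV realn.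
have [Dv2 Tv2] := linopZ 2^-1 Dv.
have [Dw2 Tw2] := linopZ 2^-1 Dw.
have [Dm Tm] := linopD Dv2 Dw2.
exists (2^-1 *: v + 2^-1 *: w) => //.
rewrite /energy Tm Tv2 Tw2 -!inner_norm.
rewrite innerBl !innerBr !(innerDl, innerDr, innerZl) !innerZr_real //.
by field.
Qed.

(** At a near-minimiser v, the derivative of the energy in every direction w
    is small: otherwise a step against it would go below the infimum m. *)
Lemma energy_near_min H K (T : linop K H) k m e v w :
  (forall x, dom T x -> m <= energy T k x) ->
  dom T v -> dom T w -> energy T k v < m + e ->
  `|'<T w, T v> - '<w, k>| ^+ 2 < e * (`|T w| ^+ 2 + 1).
Proof.
move=> mE Dv Dw Eve.
have c0 : 0 < `|T w| ^+ 2 + 1 by rewrite ltr_wpDl // exprn_ge0.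
(* A step length for which t * |T w| ^ 2 = 1 - t stays below 1. *)
pose t := (`|T w| ^+ 2 + 1)^-1.
have t0 : 0 < t by rewrite invr_gt0.
have := energy_step k Dv Dw (gtr0_real t0).
set z := '<T w, T v> - '<w, k> => step.
have : m <= energy T k ((- t * conj z) *: w + v) by apply/mE/dom_linear.
have -> := step; rewrite lerBrDr => /le_lt_trans/(_ Eve).
rewrite ltrD2l => tze; rewrite -ltr_pdivrMr // mulrC.
apply: le_lt_trans tze.
have -> : 2 - t * `|T w| ^+ 2 = 1 + t.
  by rewrite /t; field; rewrite gt_eqF.
by rewrite ler_peMr ?lerDl ?mulr_ge0 ?exprn_ge0 // ltW.
Qed.

(** The midpoint of v and w has an energy that is at least m and, by
    [energy_midpoint], far below m + e if T v and T w are far apart. *)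
Lemma energy_near_min_close H K (T : linop K H) k m e v w :
  (forall x, dom T x -> m <= energy T k x) -> dom T v -> dom T w ->
  energy T k v < m + e -> energy T k w < m + e -> `|T v - T w| ^+ 2 < 4 * e.
Proof.
move=> mE Dv Dw Eve Ewe.
have [x /mE + Ex] := energy_midpoint k Dv Dw.
rewrite Ex lerBrDr => mEvw.
have : (energy T k v + energy T k w) / 2 < m + e.
  by rewrite ltr_pdivrMr // mulr_natr mulr2n ltrD.
by move=> /(le_lt_trans mEvw); rewrite ltrD2l ltr_pdivrMr // mulrC.
Qed.

(** The images by T of a minimising sequence for the energy are a Cauchy
    sequence, and its limit represents the functional T v |-> <v, k> because the
    derivatives of the energy tend to 0 along the sequence.  This covers both
    the Riesz theorem on ran T and, for an inclusion map T, orthogonal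
    projection onto the closure of a subspace. *)
Lemma weak_riesz H K (T : linop K H) (k : K) (C : F) : 0 <= C ->
  (forall v, dom T v -> `|'<v, k>| <= C * `|T v|) ->
  exists2 h, closure (ran T) h &
    (forall v, dom T v -> '<T v, h> = '<v, k>).
Proof.
move=> C0 TC.
have [|||m [mA Em]] :=
    real_inf_exists F_RC (A := energy T k @` dom T) (b := - C ^+ 2).
- by exists (energy T k 0), 0 => //; exact: dom0.
- by move=> _ [v Dv <-]; apply: energy_ge => //; exact: TC.
- by move=> _ [v _ <-]; exact: energy_real.
have mE v : dom T v -> m <= energy T k v by move=> Dv; apply: mA; exists v.
have minimising (n : nat) :
    exists v, dom T v /\ energy T k v < m + n.+1%:R^-1.
  have [|_ [v Dv <-] Ev] := Em n.+1%:R^-1; first by rewrite invr_gt0.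
  by exists v.
have [u uP] := choice minimising.
have Du n : dom T (u n) := (uP n).1.
have Eu e : 0 < e -> \forall n \near \oo, energy T k (u n) < m + e.
  move=> /(near_harmonic_lt F_RC); apply: filterS => n ne.
  by apply: lt_trans (uP n).2 _; rewrite ltrD2l.
have : cvg (T (u n) @[n --> \oo]).
  apply/cauchy_cvgP/cauchy_exP => e e0.
  have e4 : 0 < e ^+ 2 / 4 by rewrite divr_gt0 ?exprn_gt0.
  have /filter_ex[N EN] := Eu _ e4.
  exists (T (u N)); apply: (@filterS _ \oo _ _ _ _ (Eu _ e4)) => n En.
  rewrite /= -ball_normE /=.
  have := energy_near_min_close mE (Du N) (Du n) EN En.
  by rewrite mulrC divfK // ltr_pXn2r // nnegrE ?normr_ge0 // ltW.
move=> /cvg_ex[h uh]; exists h.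
  move=> B Bh; have /filter_ex[n Bn] : \forall n \near \oo, B (T (u n)).
    exact: (uh _ Bh).
  by exists (T (u n)); split=> //; exists (u n).
move=> w Dw; rewrite innerC [RHS]innerC; congr (conj _).
apply: (cvg_unique (@norm_hausdorff F F^o) (cvg_inner uh)).
apply/cvgrPdist_lt => e e0.
have c0 : 0 < `|T w| ^+ 2 + 1 by rewrite ltr_wpDl // exprn_ge0.
have := Eu _ (divr_gt0 (exprn_gt0 2 e0) c0).
apply: filterS => n En.
have := energy_near_min mE (Du n) Dw En.
rewrite divfK ?gt_eqF // ltr_pXn2r // ?nnegrE ?normr_ge0 ?ltW //.
rewrite -(conj_norm F_RC ('<T w, T _> - _)) (conjB F_RC) -!innerC.
by rewrite distrC.
Qed.

(** Apply [weak_riesz] to the identity of dom T and the functional <., x>: it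
    yields h in the closure of dom T with x - h orthogonal to dom T. *)
Lemma densely_defined_perp H K (T : linop H K) :
  (forall x, (forall h, dom T h -> '<h, x> = 0) -> x = 0) -> densely_defined T.
Proof.
move=> Tperp O [x Ox] oO.
pose I := @Linop F conj H H (dom T) idfun (dom0 T) (@dom_linear _ _ _ _ T)
  (fun _ _ _ _ _ => erefl).
have [|h clh hx] := @weak_riesz H H I x `|x| (normr_ge0 _).
  by move=> v _; rewrite mulrC; exact: cauchy_schwarz.
have xh : x = h.
  apply/eqP; rewrite -subr_eq0; apply/eqP/Tperp => v Dv.
  by rewrite innerBr hx ?subrr.
have [|_ [[v Dv <-] Ov]] := clh O.
  by apply: open_nbhs_nbhs; rewrite -xh.
by exists v.
Qed.

(** * The sets R_T, Q_S, N_S and the closed graph *)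

(** R_T is the range of the adjoint relation.  If k is in R_T, the bound scales
    to |<v, k>| <= M * |T v|, and [weak_riesz] applies; the converse is the
    Cauchy-Schwarz inequality. *)
Lemma R_setP H K (T : linop K H) k :
  R_set T k <-> exists h, adjoint_rel T h k.
Proof.
split=> [[M RM]|[h hk]]; last first.
  exists `|h| => _ [v [Dv Tv1] <-].
  rewrite inner_norm_sym -hk //; apply: le_trans (cauchy_schwarz _ _) _.
  by rewrite ler_piMl.
have M0 : 0 <= M.
  apply: le_trans (RM `|'<k, 0>| _); first exact: normr_ge0.
  exists 0 => //; split; first exact: dom0.
  have [_] := linopZ 0 (dom0 T); rewrite !scale0r => ->.
  by rewrite normr0.
have scale (a : F) v : dom T v -> `|a| * `|T v| <= 1 -> `|a| * `|'<v, k>| <= M.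
  move=> /(linopZ a)[Dv Tv]; rewrite -normrZ -Tv => av1.
  rewrite -normrM -innerZl inner_norm_sym.
  by apply: RM; exists (a *: v) => //; split.
have [v Dv|h _ hk] := @weak_riesz H K T k M M0; last by exists h.
have [T0|T0] := eqVneq (T v) 0.
  (* All multiples of v are admissible, so <v, k> has to vanish: otherwise
     some multiple exceeds M. *)
  rewrite T0 normr0 mulr0; have [->|vk] := eqVneq '<v, k> 0.
    by rewrite normr0.
  have := scale ((M + 1) / '<v, k>) v Dv.
  rewrite T0 normr0 mulr0 => /(_ ler01).
  rewrite -normrM divfK // ger0_norm ?addr_ge0 //.
  by rewrite lt_geF // ltrDl.
have Tv : 0 < `|T v| by rewrite normr_gt0.
have := scale (`|T v|^-1) v Dv.
rewrite normfV normr_id mulVf ?gt_eqF // => /(_ (lexx _)).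
by rewrite mulrC ler_pdivrMr.
Qed.

Lemma orthogonal_ranP H K (T : linop H K) k :
  orthogonal_complement (ran T) k <-> adjoint_rel T k 0.
Proof.
split=> [kT v Tv|kT _ [v Tv <-]]; last by rewrite inner0_sym // kT ?linear0r.
by rewrite linear0r inner0_sym // kT //; exists v.
Qed.

Lemma N_set_limit H K (S : linop H K) h : N_set S h -> graph_limit S h 0.
Proof. by move=> [[u [Du uh Su]] N]; exists u; split=> //; exact: N. Qed.

Lemma Q_setP H K (S : linop H K) k : Q_set S k <-> exists h, graph_limit S h k.
Proof.
split=> [[u [Du /cvg_ex[h uh] uk]]|[h [u [Du uh uk]]]]; first by exists h, u.
by exists u; split=> //; apply/cvg_ex; exists h.
Qed.

(** Without single-valuedness N_S may be smaller: the second clause of its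
    definition asks that every limit over h be 0. *)
Lemma N_setP H K (S : linop H K) h :
  (forall k l, graph_limit S h k -> graph_limit S h l -> k = l) ->
  N_set S h <-> graph_limit S h 0.
Proof.
move=> S_fun; split=> [/N_set_limit//|h0]; split.
  by have [u [Du uh u0]] := h0; exists u; split=> //; apply/cvg_ex; exists 0.
move=> u Du uh /cvg_ex[l ul]; rewrite (S_fun 0 l) //.
by exists u.
Qed.

(** * The closure of S and the adjoint of T *)

Lemma graph_adjointP H K (T : linop H K) (dT : densely_defined T) h k :
  graph (adjoint dT) (h, k) <-> adjoint_rel T h k.
Proof.
split=> [[/= Th ->]|hk]; first exact: adjoint_funP.
have Th : adjoint_dom T h by exists k.
by split=> //=; apply: (adjoint_rel_inj dT hk); exact: adjoint_funP.
Qed.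

Lemma op_eqP H K (S T : linop H K) : op_eq S T <-> graph S = graph T.
Proof.
split=> [[DST ST]|gST].
  apply/seteqP; split=> -[h k] [/= Dh ->].
    by rewrite ST //; split=> //=; rewrite -DST.
  by rewrite -DST in Dh; rewrite -ST.
have sub h : dom S h -> dom T h /\ S h = T h.
  move=> Dh; have : graph S (h, S h) by [].
  by rewrite gST.
split; last by move=> h /sub[].
apply/seteqP; split=> h; first by case/sub.
move=> Dh; have : graph T (h, T h) by [].
by rewrite -gST => -[].
Qed.

(** Closability needs no separate treatment: the closed graph is that of an
    operator as soon as it coincides with the graph of the adjoint. *)
Lemma closure_eq_adjointP H K (S : linop H K) (T : linop K H) :
  (exists (cS : closable S) (dT : densely_defined T),
     op_eq (op_closure cS) (adjoint dT)) <->
  densely_defined T /\ (forall h k, graph_limit S h k <-> adjoint_rel T h k).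
Proof.
split=> [[cS [dT /op_eqP]]|[dT lim]].
  rewrite /op_closure (projT2 (cid cS)) => clS; split=> // h k.
  by rewrite -closure_graphP clS graph_adjointP.
have clS : graph (adjoint dT) = closure (graph S).
  apply/seteqP; split=> -[h k].
    by move=> /graph_adjointP/lim/closure_graphP.
  by move=> /closure_graphP/lim/graph_adjointP.
pose cS : closable S := ex_intro _ (adjoint dT) clS.
exists cS, dT; apply/op_eqP.
by rewrite /op_closure (projT2 (cid cS)) clS.
Qed.

Lemma conditions_of_closure_eq_adjoint H K (S : linop H K) (T : linop K H) :
  densely_defined T -> (forall h k, graph_limit S h k <-> adjoint_rel T h k) ->
  [/\ wedge S T, orthogonal_complement (ran T) = N_set S &
      Q_set S = R_set T].
Proof.
move=> dT lim; split.
- move=> h k Sh Tk; rewrite innerC [RHS]innerC; congr (conj _); symmetry.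
  suff : adjoint_rel T h (S h) by apply.
  by apply/lim; exists (fun=> h); split=> //; exact: cvg_cst.
- have S_fun h k l : graph_limit S h k -> graph_limit S h l -> k = l.
    by move=> /lim hk /lim; exact: adjoint_rel_inj hk.
  apply/seteqP; split=> h.
    by move=> /orthogonal_ranP/lim; move/N_setP; apply; exact: S_fun.
  by move=> /N_set_limit/lim/orthogonal_ranP.
- apply/seteqP; split=> k.
    by move=> /Q_setP[h /lim hk]; apply/R_setP; exists h.
  by move=> /R_setP[h /lim hk]; apply/Q_setP; exists h.
Qed.

Lemma closure_eq_adjoint_of_conditions H K (S : linop H K) (T : linop K H) :
  wedge S T -> orthogonal_complement (ran T) = N_set S ->
  Q_set S = R_set T ->
  densely_defined T /\ (forall h k, graph_limit S h k <-> adjoint_rel T h k).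
Proof.
move=> ST NT QR.
have lim_adj h k : graph_limit S h k -> adjoint_rel T h k.
  exact: graph_limit_adjoint.
split.
  (* Such a k satisfies [adjoint_rel T 0 k]; the equality Q_S = R_T produces a
     limit pair (h, k), and N_S forces its second component to vanish. *)
  apply: densely_defined_perp => k kT.
  have : R_set T k.
    by apply/R_setP; exists 0 => v Tv; rewrite linear0r kT.
  rewrite -QR => -[u [Du /cvg_ex[h uh] uk]].
  have hk : adjoint_rel T h k by apply: lim_adj; exists u.
  have [_ N] : N_set S h.
    rewrite -NT; apply/orthogonal_ranP => v Tv.
    by rewrite hk // kT // linear0r.
  apply: (cvg_unique (@norm_hausdorff _ K) uk).
  by apply: N => //; apply/cvg_ex; exists k.
move=> h k; split; first exact: lim_adj.
move=> hk.
have /Q_setP[g gk] : Q_set S k by rewrite QR; apply/R_setP; exists h.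
(* (h, k) is the sum of the limit pairs (g, k) and (h - g, 0). *)
have hg0 : N_set S (h - g).
  rewrite -NT; apply/orthogonal_ranP => v Tv.
  by rewrite innerBr hk // (lim_adj _ _ gk) // subrr linear0r.
by rewrite -(subrK g h) -[k]add0r; apply: graph_limitD (N_set_limit hg0) gk.
Qed.

End HilbertSpace.

Theorem theorem4p13 (R : realType) (F : numFieldType) (conj : F -> F)
    (F_RC : real_or_complex R conj) (H K : hilbert conj)
    (S : linop H K) (T : linop K H) :
  (exists (cS : closable S) (dT : densely_defined T),
     op_eq (op_closure cS) (adjoint dT))
  <->
  [/\ wedge S T,
      orthogonal_complement (ran T) = N_set S &
      Q_set S = R_set T].
Proof.
apply: (iff_trans (closure_eq_adjointP F_RC S T)).
split=> [[dT lim]|[ST NT QR]].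
  exact: (conditions_of_closure_eq_adjoint F_RC dT lim).
exact: (closure_eq_adjoint_of_conditions F_RC ST NT QR).
Qed.
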